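(* Let $(S,+)$ be a Clifford semigroup. The following data are equivalent: (1) a binary operation $\circ$ on $S$ such that $(S,+,\circ)$ is a weak left brace (respectively, a dual weak left brace); (2) a good inverse (respectively, good Clifford) subsemigroup of $\mathrm{End}(S,+)\rtimes(S,+)$; (3) a Gamma function (respectively, a dual Gamma function) on $(S,+)$.
   Context: A semigroup $(S,+)$ (not necessarily commutative) is an inverse semigroup if for each $a\in S$ there is a unique element $-a\in S$ with $a-a+a=a$ and $-a+a-a=-a$; for an inverse semigroup $(S,\cdot)$ written multiplicatively this element is written $a^{-1}$. $E(S,+)$ is the set of idempotents of $(S,+)$. An inverse semigroup $(S,+)$ is a Clifford semigroup if $-a+a=a-a$ for all $a\in S$; then $a^0:=-a+a=a-a$. A subsemigroup is an inverse (respectively, Clifford) subsemigroup if it is an inverse (respectively, Clifford) semigroup under the restricted operation. $\mathrm{End}(S,+)$ is the semigroup of semigroup endomorphisms of $(S,+)$ under composition of maps, $fg=f\circ g$. A weak left brace is a triple $(S,+,\cdot)$ with $(S,+)$ and $(S,\cdot)$ inverse semigroups such that $x(y+z)=xy-x+xz$ and $xx^{-1}=-x+x$ for all $x,y,z\in S$, where $x^{-1}$ is the inverse of $x$ in $(S,\cdot)$. It is a dual weak left brace if moreover $(S,\cdot)$ is a Clifford semigroup. For a Clifford semigroup $(S,+)$, $\mathrm{End}(S,+)\rtimes(S,+)$ is the set $\mathrm{End}(S,+)\times S$ with the associative multiplication $(f,x)(g,y)=(fg,\,x+f(y))$. An inverse (respectively, Clifford) subsemigroup $H$ of it is called good if: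 (G1) $H\to S$, $(f,x)\mapsto x$, is a bijection; (G2) if $(f,x)\in H$ and $(f,x)^{-1}=(g,y)$ (inverse in $H$), then $(f,f(-y))\in H$; (G3) if $(f,x)\in H$, then $-x+x+f(y)=f(y)$ for all $y\in S$; (G4) if $(S,+)$ has an identity $0$, then $f(0)=-x+x$ for all $(f,x)\in H$. A map $\gamma:S\to\mathrm{End}(S,+)$, $x\mapsto\gamma_x$, is a Gamma function on $(S,+)$ if for all $x,y\in S$: (F1) $\gamma_x\gamma_y=\gamma_{x+\gamma_x(y)}$, $\gamma_{x^0}(x)=x$ and $x^0+\gamma_x(y)=\gamma_x(y)$; (F2) if $\gamma_x(x)=x^0$, then $x=x^0$; (F3) there exists $x^{-1}\in S$ such that $\gamma_x(x^{-1})=-x$ and $\gamma_{x^{-1}}(x)=-x^{-1}$; (F4) if $e,f\in E(S,+)$, then $\gamma_e(f)=e+f$. Let $H_x=\{a\in S\mid a^0=x^0\}$, a subgroup of $(S,+)$ with identity $x^0$. A map $\gamma:S\to\mathrm{End}(S,+)$, $x\mapsto\gamma_x$, is a dual Gamma function on $(S,+)$ if for all $x,y\in S$: (D1) $\gamma_x|_{H_x}$ is an automorphism of the subgroup $(H_x,+)$ of $(S,+)$; (D2) $\gamma_x\gamma_y=\gamma_{x+\gamma_x(y)}$ and $x^0+\gamma_x(y)=\gamma_x(y)$; (D3) if $e,f\in E(S,+)$, then $\gamma_e(f)=e+f$. *)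

(* Defs.v *)
From mathcomp Require Import all_boot.
From mathcomp Require Import boolp classical_sets functions.

Set Implicit Arguments.
Unset Strict Implicit.
Unset Printing Implicit Defensive.

Local Open Scope classical_set_scope.

Section SemigroupPredicates.
Context {T : Type}.
Implicit Types (op : T -> T -> T) (H : set T).

Definition inverse_of op (a b : T) : Prop :=
  op (op a b) a = a /\ op (op b a) b = b.

Definition inverse_semigroup op : Prop :=
  associative op /\ forall a, exists! b, inverse_of op a b.

Definition clifford_semigroup op : Prop :=
  inverse_semigroup op /\ forall a b, inverse_of op a b -> op b a = op a b.

Definition subsemigroup op H : Prop :=
  forall a b, H a -> H b -> H (op a b).

(* Inverses are sought inside H.  Associativity of the restricted operation is
   inherited from op, which is associative wherever this is used. *)
Definition inverse_subsemigroup op H : Prop :=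
  subsemigroup op H /\
  forall a, H a -> exists! b, H b /\ inverse_of op a b.

Definition clifford_subsemigroup op H : Prop :=
  inverse_subsemigroup op H /\
  forall a b, H a -> H b -> inverse_of op a b -> op b a = op a b.

End SemigroupPredicates.

Record inverseSemigroup := InverseSemigroup {
  sg_sort :> Type;
  sg_add : sg_sort -> sg_sort -> sg_sort;
  sg_opp : sg_sort -> sg_sort;
  sg_addA : associative sg_add;
  sg_oppP : forall a, unique (inverse_of sg_add a) (sg_opp a) }.

Declare Scope sg_scope.
Delimit Scope sg_scope with sg.
Notation "x + y" := (sg_add x y) : sg_scope.
Notation "- x" := (sg_opp x) : sg_scope.
Notation "x - y" := (sg_add x (sg_opp y)) : sg_scope.
Local Open Scope sg_scope.

Definition clifford (S : inverseSemigroup) : Prop :=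
  clifford_semigroup (@sg_add S).

(* The element a^0, which equals a - a when S is Clifford. *)
Definition zero_at (S : inverseSemigroup) (a : S) : S := - a + a.

Definition idempotent_elt (S : inverseSemigroup) (e : S) : Prop := e + e = e.

Definition sg_identity (S : inverseSemigroup) (o : S) : Prop :=
  left_id o (@sg_add S) /\ right_id o (@sg_add S).

Record endo (S : inverseSemigroup) := Endo {
  endo_fun :> S -> S;
  endoD : forall x y : S, endo_fun (x + y) = endo_fun x + endo_fun y }.

Lemma endo_compD (S : inverseSemigroup) (f g : endo S) (x y : S) :
  f (g (x + y)) = f (g x) + f (g y).
Proof. by rewrite !endoD. Qed.

Definition endo_comp (S : inverseSemigroup) (f g : endo S) : endo S :=
  @Endo S (fun x => f (g x)) (endo_compD f g).

Lemma endo_eqP (S : inverseSemigroup) (f g : endo S) : f =1 g -> f = g.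
Proof.
case: f g => [f fD] [g gD] /= /funext fg.
by case: _ / fg in gD *; rewrite (Prop_irrelevance fD gD).
Qed.

Definition sdmul (S : inverseSemigroup) (p q : endo S * S) : endo S * S :=
  (endo_comp p.1 q.1, p.2 + p.1 q.2).

Lemma sdmulA (S : inverseSemigroup) : associative (@sdmul S).
Proof.
move=> [f x] [g y] [h z]; rewrite /sdmul /=; congr pair; first exact: endo_eqP.
by rewrite endoD sg_addA.
Qed.

Section Data.
Variable S : inverseSemigroup.
Implicit Types (mul : S -> S -> S) (H : set (endo S * S)) (gam : S -> endo S).

Definition weak_left_brace mul : Prop :=
  [/\ inverse_semigroup mul,
      forall x y z, mul x (y + z) = mul x y - x + mul x z
    & forall x x', inverse_of mul x x' -> mul x x' = - x + x].

Definition dual_weak_left_brace mul : Prop :=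
  weak_left_brace mul /\ clifford_semigroup mul.

Definition good H : Prop :=
  [/\ set_bij H setT snd,
      forall f x g y, H (f, x) -> H (g, y) ->
        inverse_of (@sdmul S) (f, x) (g, y) -> H (f, f (- y)),
      forall f x, H (f, x) -> forall y, - x + x + f y = f y
    & forall o, sg_identity o -> forall f x, H (f, x) -> f o = - x + x].

Definition good_inverse_subsemigroup H : Prop :=
  inverse_subsemigroup (@sdmul S) H /\ good H.

Definition good_clifford_subsemigroup H : Prop :=
  clifford_subsemigroup (@sdmul S) H /\ good H.

Record gamma_function gam : Prop := GammaFunction {
  gammaM : forall x y, endo_comp (gam x) (gam y) = gam (x + gam x y);
  gamma_zero_id : forall x, gam (zero_at x) x = x;
  gamma_zero_add : forall x y, zero_at x + gam x y = gam x y;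
  gamma_zero_eq : forall x, gam x x = zero_at x -> x = zero_at x;
  gamma_inv : forall x, exists x', gam x x' = - x /\ gam x' x = - x';
  gamma_idem : forall e f, idempotent_elt e -> idempotent_elt f ->
    gam e f = e + f }.

(* The subgroup H_x of all a with a^0 = x^0. *)
Definition zero_class (x : S) : set S := [set a | zero_at a = zero_at x].

(* Additivity on H_x is part of gam x : endo S, so being an automorphism of
   H_x amounts to restricting to a bijection of H_x onto itself. *)
Record dual_gamma_function gam : Prop := DualGammaFunction {
  dgamma_aut : forall x, set_bij (zero_class x) (zero_class x) (gam x);
  dgammaM : forall x y, endo_comp (gam x) (gam y) = gam (x + gam x y);
  dgamma_zero_add : forall x y, zero_at x + gam x y = gam x y;
  dgamma_idem : forall e f, idempotent_elt e -> idempotent_elt f ->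
    gam e f = e + f }.

Definition brace_of_gamma gam : S -> S -> S := fun x y => x + gam x y.

Definition sub_of_gamma gam : set (endo S * S) := [set p : endo S * S | p.1 = gam p.2].

(* The pairs (lambda_x, x) with lambda_x(y) = - x + xy. *)
Definition sub_of_brace mul : set (endo S * S) :=
  [set p : endo S * S | forall y, p.1 y = - p.2 + mul p.2 y].

(* The three kinds of data determine each other: the canonical maps are
   bijections between them and form a commutative triangle. *)
Definition equivalent_data (B : set (S -> S -> S))
    (G : set (set (endo S * S))) (Gam : set (S -> endo S)) : Prop :=
  [/\ set_bij B G sub_of_brace,
      set_bij Gam G sub_of_gamma,
      set_bij Gam B brace_of_gamma
    & forall gam, Gam gam ->
        sub_of_brace (brace_of_gamma gam) = sub_of_gamma gam].

End Data.

(* Main.v *)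
(** The three kinds of data are linked by [x \o y = x + gamma_x(y)], that is
    [gamma_x(y) = - x + x \o y]: the graph of [gamma] in [End(S,+) x S] is
    closed under multiplication exactly when [gamma] satisfies the first
    identity of a Gamma function, and it is then isomorphic to [(S, \o)] by
    the second projection.  In all cases the point is that the idempotents of
    [(S, \o)] are those of [(S,+)], and that [\o] and [+] agree on them.  A
    dual Gamma function is a Gamma function for which [(S, \o)] is Clifford:
    surjectivity of [gamma_x] on [H_x] provides the inverse of [x], which again
    lies in [H_x]. *)
Require Import Defs.
From mathcomp Require Import all_boot.
From mathcomp Require Import boolp classical_sets functions.

Set Implicit Arguments.
Unset Strict Implicit.
Unset Printing Implicit Defensive.

Local Open Scope classical_set_scope.
Local Open Scope sg_scope.

(** * Uniqueness of inverses and commutation of idempotents *)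

Section InverseSemigroups.
Context {T : Type} (op : T -> T -> T).
Hypothesis opA : associative op.
Local Notation "x * y" := (op x y).

Lemma inverse_ofC a b : inverse_of op a b -> inverse_of op b a.
Proof. by case. Qed.

Lemma idem_inverse_of e : e * e = e -> inverse_of op e e.
Proof. by move=> ee; split; rewrite !ee. Qed.

Lemma inverse_of_idem a b : inverse_of op a b -> (a * b) * (a * b) = a * b.
Proof. by case=> aba bab; rewrite opA aba. Qed.

(** Two inverses [b] and [c] of [a] both equal [c * a * b]: commute [b * a] with [c * a] for the
    first, [a * b] with [a * c] for the second. *)
Lemma commuting_idem_inverse_semigroup :
  (forall a, exists b, inverse_of op a b) ->
  (forall e f, e * e = e -> f * f = f -> e * f = f * e) ->
  inverse_semigroup op.
Proof.
move=> reg comm; split=> // a; have [b ab] := reg a; exists b; split=> // c ac.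
have bac : (b * a) * (c * a) = (c * a) * (b * a).
  by apply: comm; apply: inverse_of_idem; apply: inverse_ofC.
have abc : (a * b) * (a * c) = (a * c) * (a * b).
  by apply: comm; apply: inverse_of_idem.
transitivity (c * a * b).
  transitivity ((b * a) * (c * a) * b); last by rewrite bac -!opA (opA b) ab.2.
  have -> : b * a * (c * a) * b = b * (a * c * a) * b by rewrite !opA.
  by rewrite ac.1 ab.2.
transitivity (c * ((a * b) * (a * c))).
  by rewrite abc !opA ac.2.
have -> : c * (a * b * (a * c)) = c * (a * b * a) * c by rewrite !opA.
by rewrite ab.1 ac.2.
Qed.

Hypothesis inv_op : inverse_semigroup op.

Lemma inverse_of_uniq a b c : inverse_of op a b -> inverse_of op a c -> b = c.
Proof. by case: (inv_op.2 a) => d [_ du] /du <- /du <-. Qed.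

Lemma inverse_of_ex a : exists b, inverse_of op a b.
Proof. by case: (inv_op.2 a) => d [? _]; exists d. Qed.

(** If [x] is the inverse of [e * f], then so is [f * x * e], hence [x = f * x * e]. This makes [x]
    idempotent, so [x] is its own inverse and equals [e * f]. *)
Lemma idem_mul e f : e * e = e -> f * f = f -> (e * f) * (e * f) = e * f.
Proof.
move=> ee ff; have [x xP] := inverse_of_ex (e * f).
have xE : x = f * x * e.
  apply: (inverse_of_uniq xP); split.
    have -> : e * f * (f * x * e) * (e * f) = e * (f * f) * x * (e * e) * f.
      by rewrite !opA.
    by rewrite ee ff -(opA _ e) xP.1.
  have -> : f * x * e * (e * f) * (f * x * e) =
      f * (x * ((e * e) * (f * f)) * x) * e by rewrite !opA.
  by rewrite ee ff xP.2.
have xx : x * x = x.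
  rewrite {1 2}xE.
  have -> : f * x * e * (f * x * e) = f * (x * (e * f) * x) * e by rewrite !opA.
  by rewrite xP.2 -xE.
by rewrite (inverse_of_uniq (inverse_ofC xP) (idem_inverse_of xx)).
Qed.

(** The idempotent [e * f] is its own inverse, and [f * e] is another inverse of it. *)
Lemma idemC e f : e * e = e -> f * f = f -> e * f = f * e.
Proof.
move=> ee ff; apply: (inverse_of_uniq (idem_inverse_of (idem_mul ee ff))).
have efef := idem_mul ee ff; have fefe := idem_mul ff ee; split.
  have -> : e * f * (f * e) * (e * f) = e * (f * f) * (e * e) * f.
    by rewrite !opA.
  by rewrite ee ff -(opA _ e).
have -> : f * e * (e * f) * (f * e) = f * (e * e) * (f * f) * e.
  by rewrite !opA.
by rewrite ee ff -(opA _ f).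
Qed.

Lemma inverse_ofM a b a' b' : inverse_of op a a' -> inverse_of op b b' ->
  inverse_of op (a * b) (b' * a').
Proof.
move=> aP bP.
have c : (b * b') * (a' * a) = (a' * a) * (b * b').
  by apply: idemC; apply: inverse_of_idem => //; apply: inverse_ofC.
split.
  have -> : a * b * (b' * a') * (a * b) = a * ((b * b') * (a' * a)) * b.
    by rewrite !opA.
  by rewrite c !opA aP.1 -!opA (opA b) bP.1.
have -> : b' * a' * (a * b) * (b' * a') = b' * ((a' * a) * (b * b')) * a'.
  by rewrite !opA.
by rewrite -c !opA bP.2 -!opA (opA a') aP.2.
Qed.

End InverseSemigroups.

(** * Negation, [zero_at] and idempotents in a Clifford semigroup *)

Section CliffordSemigroups.
Variable S : inverseSemigroup.
Hypothesis cliffordS : clifford S.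
Implicit Types (x y z e f : S) (gam : S -> endo S).

Let addA := @sg_addA S.

Lemma opp_inverse_of x : inverse_of (@sg_add S) x (- x).
Proof. by case: (sg_oppP x). Qed.

Lemma opp_unique x y : inverse_of (@sg_add S) x y -> - x = y.
Proof. by case: (sg_oppP x) => _; apply. Qed.

Lemma opp_opp x : - - x = x.
Proof. by apply/opp_unique/inverse_ofC/opp_inverse_of. Qed.

Lemma opp_add x y : - (x + y) = - y - x.
Proof.
by apply/opp_unique/(inverse_ofM addA cliffordS.1); exact: opp_inverse_of.
Qed.

Lemma opp_idem e : idempotent_elt e -> - e = e.
Proof. by move=> ee; apply/opp_unique/idem_inverse_of. Qed.

Lemma subxx x : x - x = zero_at x.
Proof. by rewrite /zero_at (cliffordS.2 _ _ (opp_inverse_of x)). Qed.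

Lemma zero_at_idem x : idempotent_elt (zero_at x).
Proof. by apply/inverse_of_idem/inverse_ofC/opp_inverse_of/addA. Qed.

Lemma add_zero_at x : x + zero_at x = x.
Proof. by rewrite /zero_at addA; exact: (opp_inverse_of x).1. Qed.

Lemma zero_at_add x : zero_at x + x = x.
Proof. by rewrite -subxx; exact: (opp_inverse_of x).1. Qed.

Lemma zero_at_opp x : zero_at (- x) = zero_at x.
Proof. by rewrite /zero_at opp_opp subxx. Qed.

Lemma zero_at_id e : idempotent_elt e -> zero_at e = e.
Proof. by move=> ee; rewrite /zero_at opp_idem. Qed.

Lemma add_idemC e f :
  idempotent_elt e -> idempotent_elt f -> e + f = f + e.
Proof. exact: idemC addA cliffordS.1 _ _. Qed.

(** Computing [zero_at (e + x)] from both sides gives [e + zero_at x = - x + e + x]; adding [x] on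
    the left yields the claim. *)
Lemma idem_central e x : idempotent_elt e -> e + x = x + e.
Proof.
move=> ee; have := subxx (e + x); rewrite /zero_at opp_add (opp_idem ee).
rewrite -!addA (addA e e) ee (addA x) subxx.
rewrite (add_idemC (zero_at_idem x) ee) (addA e e) ee.
move=> /(congr1 (sg_add x)); rewrite (add_idemC ee (zero_at_idem x)) !addA.
rewrite subxx zero_at_add (add_idemC (zero_at_idem x) ee) -addA zero_at_add.
by move=> ->.
Qed.

Lemma add_zero_fix x y : zero_at x + zero_at y = zero_at y -> zero_at x + y = y.
Proof. by move=> xy; rewrite -{1}(zero_at_add y) addA xy zero_at_add. Qed.

Lemma opp_add_eq x y z : zero_at x + y = y -> x + y = z -> y = - x + z.
Proof. by move=> xy <-; rewrite addA. Qed.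

Lemma endo_opp (f : endo S) x : f (- x) = - f x.
Proof.
apply/esym/opp_unique; have [x1 x2] := opp_inverse_of x.
by split; rewrite -!endoD ?x1 ?x2.
Qed.

Lemma endo_zero_at (f : endo S) x : f (zero_at x) = zero_at (f x).
Proof. by rewrite /zero_at endoD endo_opp. Qed.

(** * From [gam] to its operation and its graph, under the identities common to Gamma and dual Gamma
    functions *)

Section GammaToBrace.
Variable gam : S -> endo S.
Local Notation mul := (brace_of_gamma gam).

Hypothesis gamM : forall x y, endo_comp (gam x) (gam y) = gam (mul x y).
Hypothesis gam_zero : forall x y, zero_at x + gam x y = gam x y.

Lemma gammaE x y z : gam x (gam y z) = gam (mul x y) z.
Proof. by rewrite -gamM. Qed.

Lemma brace_of_gammaA : associative mul.
Proof.
move=> x y z; change (x + gam x (y + gam y z) = mul x y + gam (mul x y) z).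
by rewrite -gammaE endoD addA.
Qed.

Lemma gamma_opp_mul x y : gam x y = - x + mul x y.
Proof. exact: opp_add_eq. Qed.

Lemma brace_of_gammaD x y z : mul x (y + z) = mul x y - x + mul x z.
Proof.
rewrite /brace_of_gamma endoD -!addA (addA (- x)) -/(zero_at x).
by rewrite gam_zero.
Qed.

Lemma mul_idem_gamma e : mul e e = e -> gam e e = zero_at e.
Proof. by move=> ee; rewrite gamma_opp_mul ee. Qed.

(** [gamma_inv] and [gamma_zero_id] provide inverses; [gamma_zero_eq] turns idempotents of [mul]
    into additive ones, and these commute for [mul] by [gamma_idem]. *)
Lemma weak_left_brace_of_gamma : gamma_function gam -> weak_left_brace mul.
Proof.
move=> gamP.
have mulV x y : gam x y = - x -> mul x y = zero_at x.
  by rewrite /brace_of_gamma => ->; rewrite subxx.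
have inv x : exists y, inverse_of mul x y /\ mul x y = zero_at x.
  have [y [xy yx]] := gamma_inv gamP x; exists y; split; last exact: mulV.
  rewrite /inverse_of (mulV x y xy) (mulV y x yx).
  by rewrite /brace_of_gamma !(gamma_zero_id gamP) !zero_at_add.
have idem e : mul e e = e -> idempotent_elt e.
  move=> /mul_idem_gamma /(gamma_zero_eq gamP) ->; exact: zero_at_idem.
have invS : inverse_semigroup mul.
  apply: commuting_idem_inverse_semigroup.
  - exact: brace_of_gammaA.
  - by move=> x; have [y [? _]] := inv x; exists y.
  - move=> e f /idem ee /idem ff; rewrite /brace_of_gamma !(gamma_idem gamP) //.
    by rewrite !addA ee ff add_idemC.
split=> //; first exact: brace_of_gammaD.
move=> x x' xx'; have [y [xy xV]] := inv x; rewrite -/(zero_at x) -xV.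
by rewrite (inverse_of_uniq invS xx' xy).
Qed.

Lemma sdmul_graph x y :
  sdmul (gam x, x) (gam y, y) = (gam (mul x y), mul x y).
Proof. by rewrite /sdmul /= gamM. Qed.

Lemma graph_fst (f : endo S) x : sub_of_gamma gam (f, x) -> f = gam x.
Proof. by []. Qed.

Lemma inverse_of_graph x y :
  inverse_of (@sdmul S) (gam x, x) (gam y, y) <-> inverse_of mul x y.
Proof.
rewrite /inverse_of !sdmul_graph; split=> [[[_ ?] [_ ?]] //|[xyx yxy]].
by rewrite xyx yxy.
Qed.

Lemma inverse_subsemigroup_graph :
  inverse_subsemigroup (@sdmul S) (sub_of_gamma gam) <-> inverse_semigroup mul.
Proof.
split=> [[_ inv]|[_ inv]]; split.
- exact: brace_of_gammaA.
- move=> x; have [[f y] [[/graph_fst fE xy] u]] := inv (gam x, x) erefl.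
  rewrite {f}fE inverse_of_graph in xy u.
  exists y; split=> // z /inverse_of_graph xz.
  by have [] := u (gam z, z) (conj erefl xz).
- by move=> [? x] [? y] /graph_fst -> /graph_fst ->; rewrite sdmul_graph.
- move=> [? x] /graph_fst ->; have [y [xy u]] := inv x.
  exists (gam y, y); split; first by split=> //; apply/inverse_of_graph.
  by move=> [? z] [/graph_fst -> /inverse_of_graph /u ->].
Qed.

Lemma clifford_subsemigroup_graph :
  clifford_subsemigroup (@sdmul S) (sub_of_gamma gam) <->
  clifford_semigroup mul.
Proof.
split=> [[/inverse_subsemigroup_graph inv comm]|[inv comm]].
  split=> // x y xy.
  have := comm (gam x, x) (gam y, y) erefl erefl.
  by rewrite inverse_of_graph !sdmul_graph => /(_ xy) [].
split; first exact/inverse_subsemigroup_graph.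
move=> [? x] [? y] /graph_fst -> /graph_fst -> /inverse_of_graph /comm.
by rewrite !sdmul_graph => ->.
Qed.

Lemma weak_left_brace_of_good :
  good_inverse_subsemigroup (sub_of_gamma gam) -> weak_left_brace mul.
Proof.
move=> [/inverse_subsemigroup_graph invS [_ G2 _ _]].
have mulA := brace_of_gammaA.
have idem e : mul e e = e -> idempotent_elt e.
  move=> ee; have ge := mul_idem_gamma ee.
  (* An idempotent is its own inverse, so (G2) puts [(gam e, zero_at e)] in the graph, that is,
     [gam e = gam (zero_at e)]. *)
  have := G2 (gam e) e (gam e) e erefl erefl; rewrite inverse_of_graph.
  move=> /(_ (idem_inverse_of ee)) /=; rewrite /sub_of_gamma /= endo_opp ge.
  rewrite (opp_idem (zero_at_idem e)) => g0.
  have ge0 : gam e (zero_at e) = zero_at e by rewrite -{1}ge gammaE ee.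
  (* Both [e] and [zero_at e] are idempotents of [mul], hence commute; one product is [zero_at e],
     the other is [e]. *)
  suff -> : e = zero_at e by exact: zero_at_idem.
  have <- : mul (zero_at e) e = zero_at e.
    by rewrite /brace_of_gamma -g0 ge; exact: zero_at_idem.
  rewrite (idemC mulA invS) //; last first.
    by rewrite /brace_of_gamma -g0 ge0; exact: zero_at_idem.
  by rewrite /brace_of_gamma ge0 add_zero_at.
split=> //; first exact: brace_of_gammaD.
move=> x x' xx'; rewrite -/(zero_at x).
have ff := idem _ (inverse_of_idem mulA xx').
(* With [f = mul x x'], the facts [zero_at x + f = f] and [f + x = x] give [f = f + zero_at x = f +
   x - x = zero_at x]. *)
have f_le : zero_at x + mul x x' = mul x x'.
  by rewrite /brace_of_gamma addA zero_at_add.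
have x_le : mul x x' + x = x.
  by rewrite -{2 3}xx'.1 {2 3}/brace_of_gamma addA ff.
by rewrite -f_le (idem_central _ (zero_at_idem x)) -(subxx x) addA x_le.
Qed.

Lemma good_of_weak_left_brace :
  weak_left_brace mul -> good_inverse_subsemigroup (sub_of_gamma gam).
Proof.
move=> [invS _ mulV]; split; first exact/inverse_subsemigroup_graph.
have gamV x y : inverse_of mul x y -> gam x y = - x.
  move=> xy; rewrite gamma_opp_mul mulV // -/(zero_at x) -(zero_at_opp x).
  exact: add_zero_at.
split.
- split=> //.
    by move=> [? x] [? y] /set_mem/graph_fst -> /set_mem/graph_fst -> /= ->.
  by move=> x _; exists (gam x, x).
- move=> ? x ? y /graph_fst -> /graph_fst -> /inverse_of_graph xy.
  by rewrite /sub_of_gamma /= endo_opp gamV ?opp_opp.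
- by move=> ? x /graph_fst ->; exact: gam_zero.
(* For [y] inverse to [x], [gam x] sends [zero_at y] to [zero_at x]. Applying it to
   [zero_at y = o + zero_at y] gives [zero_at x = gam x o + zero_at x], and the right side is
   [gam x o] by [gam_zero]. *)
- move=> o [o0 _] ? x /graph_fst ->; have [y xy] := inverse_of_ex invS x.
  have y0 : gam x (zero_at y) = zero_at x.
    by rewrite endo_zero_at gamV // zero_at_opp.
  rewrite -/(zero_at x) -y0 -(o0 (zero_at y)) endoD y0.
  by rewrite -(idem_central _ (zero_at_idem x)) gam_zero.
Qed.

End GammaToBrace.

(** * From a weak left brace to its lambda map *)

Section BraceToGamma.
Variable mul : S -> S -> S.
Hypothesis braceS : weak_left_brace mul.

Let invS : inverse_semigroup mul. Proof. by case: braceS. Qed.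
Let mulA : associative mul. Proof. exact: invS.1. Qed.
Let mulD x y z : mul x (y + z) = mul x y - x + mul x z.
Proof. by case: braceS. Qed.
Let mulV x x' : inverse_of mul x x' -> mul x x' = zero_at x.
Proof. by case: braceS => _ _; apply. Qed.

Lemma brace_idem e : mul e e = e <-> idempotent_elt e.
Proof.
split=> [ee|ee].
  rewrite -[X in idempotent_elt X]ee (mulV (idem_inverse_of ee)).
  exact: zero_at_idem.
have [e' e'P] := inverse_of_ex invS e.
by have := inverse_of_idem mulA e'P; rewrite (mulV e'P) zero_at_id.
Qed.

(* With [h = e f] and [g = e + f]: distributivity gives [e g = h = f g] and
   [h <= g], and then [g = g (e + f) = h]. *)
Lemma brace_idem_mul e f :
  idempotent_elt e -> idempotent_elt f -> mul e f = e + f.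
Proof.
have le a b : idempotent_elt a -> idempotent_elt b ->
    idempotent_elt (mul a b) /\ a + mul a b = mul a b.
  move=> aa bb; have abab : idempotent_elt (mul a b).
    by apply/brace_idem/idem_mul => //; apply/brace_idem.
  split=> //; have := mulD a b b; rewrite bb (opp_idem aa) => {2}->.
  by rewrite -(idem_central _ aa) -addA abab.
have mulg a b : idempotent_elt a -> idempotent_elt b ->
    mul a (a + b) = mul a b.
  move=> aa bb; rewrite mulD (opp_idem aa) ((brace_idem a).2 aa) aa.
  exact: (le _ _ aa bb).2.
move=> ee ff.
have eC : mul e f = mul f e by apply: idemC => //; apply/brace_idem.
have gg : idempotent_elt (e + f) by exact: idem_mul cliffordS.1 _ _ ee ff.
have [hh _] := le _ _ ee ff.
have eg := mulg _ _ ee ff.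
have := mulg _ _ ff ee; rewrite -(add_idemC ee ff) -eC => fg.
have ge : mul (e + f) e = mul e f.
  by rewrite -eg; apply: idemC => //; apply/brace_idem.
have gf : mul (e + f) f = mul e f.
  by rewrite -fg; apply: idemC => //; apply/brace_idem.
have := mulD (e + f) e f; rewrite ((brace_idem _).2 gg) ge gf opp_idem //.
rewrite -{1}ge -(idem_central _ gg) (le _ _ gg ee).2 ge hh.
by move=> <-.
Qed.

(** [zero_at x] is [x x'] and [zero_at (mul x y)] is [x y y' x']; as idempotents they add the way
    they multiply, and [x x'] is absorbed by [x]. *)
Lemma brace_zero_at_mul x y : zero_at x + mul x y = mul x y.
Proof.
have [x' xx'] := inverse_of_ex invS x; have [y' yy'] := inverse_of_ex invS y.
have xyP := inverse_ofM mulA invS xx' yy'.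
apply: add_zero_fix; rewrite -brace_idem_mul; try exact: zero_at_idem.
by rewrite -(mulV xyP) -(mulV xx') !mulA xx'.1.
Qed.

Lemma brace_lambdaD x y z :
  - x + mul x (y + z) = (- x + mul x y) + (- x + mul x z).
Proof. by rewrite mulD !addA. Qed.

Definition brace_lambda x : endo S := Endo (brace_lambdaD x).

Lemma brace_of_lambda : brace_of_gamma brace_lambda = mul.
Proof.
apply/funext => x; apply/funext => y.
by rewrite /brace_of_gamma /= addA subxx brace_zero_at_mul.
Qed.

Lemma brace_lambda_zero x y :
  zero_at x + brace_lambda x y = brace_lambda x y.
Proof. by rewrite /= addA -{1}(zero_at_opp x) zero_at_add. Qed.

(** Expanding the left side at [z] gives [- (x y) + x - x + x y z], where [x - x] is absorbed by
    [brace_zero_at_mul]. *)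
Lemma brace_lambda_comp x y :
  endo_comp (brace_lambda x) (brace_lambda y) = brace_lambda (mul x y).
Proof.
apply: endo_eqP => z; rewrite /endo_comp.
change (brace_lambda x (- y + mul y z) = - mul x y + mul (mul x y) z).
rewrite endoD endo_opp /= opp_add opp_opp.
by rewrite -addA (addA x) subxx brace_zero_at_mul mulA.
Qed.

Lemma brace_lambda_gamma : gamma_function brace_lambda.
Proof.
have zmul x : mul (zero_at x) x = x.
  have [x' xx'] := inverse_of_ex invS x; rewrite -(mulV xx'); exact: xx'.1.
split.
- move=> x y; have := brace_lambda_comp x y.
  by rewrite -[in X in _ = brace_lambda X]brace_of_lambda.
- by move=> x /=; rewrite zmul opp_idem ?zero_at_add //; exact: zero_at_idem.
- exact: brace_lambda_zero.
- move=> x /= xx; apply/esym/zero_at_id/brace_idem.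
  by rewrite -brace_of_lambda /brace_of_gamma /= xx add_zero_at.
- move=> x; have [x' xx'] := inverse_of_ex invS x; exists x'.
  rewrite /= (mulV xx') (mulV (inverse_ofC xx')).
  by rewrite -(zero_at_opp x) -(zero_at_opp x') !add_zero_at.
- move=> e f ee ff; rewrite /= brace_idem_mul // opp_idem // addA.
  by rewrite ee.
Qed.

End BraceToGamma.

(** * Passage between Gamma functions, braces and good subsemigroups *)

Lemma brace_of_gamma_inj gam gam' :
  (forall x y, zero_at x + gam x y = gam x y) ->
  (forall x y, zero_at x + gam' x y = gam' x y) ->
  brace_of_gamma gam = brace_of_gamma gam' -> gam = gam'.
Proof.
move=> gz gz' gg; apply/funext => x; apply: endo_eqP => y.
by rewrite (gamma_opp_mul gz) gg -gamma_opp_mul.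
Qed.

(** By injectivity such a [gam] is the lambda map of its own brace. *)
Lemma gamma_of_weak_left_brace gam :
  (forall x y, zero_at x + gam x y = gam x y) ->
  weak_left_brace (brace_of_gamma gam) -> gamma_function gam.
Proof.
move=> gz brace; have gz' := brace_lambda_zero brace.
have <- := brace_of_gamma_inj gz' gz (brace_of_lambda brace).
exact: brace_lambda_gamma.
Qed.

Lemma gamma_brace gam :
  gamma_function gam -> weak_left_brace (brace_of_gamma gam).
Proof.
move=> gamP; apply: weak_left_brace_of_gamma => //.
  exact: gammaM gamP.
exact: gamma_zero_add gamP.
Qed.

Lemma gamma_good gam :
  gamma_function gam -> good_inverse_subsemigroup (sub_of_gamma gam).
Proof.
move=> gamP; apply: good_of_weak_left_brace; last exact: gamma_brace.
  exact: gammaM gamP.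
exact: gamma_zero_add gamP.
Qed.

(** By (G1), [H] is the graph of a function; closure of [H] gives its composition law and (G3) its
    absorption law. The remaining axioms are obtained through the brace. *)
Lemma good_gamma H : good_inverse_subsemigroup H ->
  exists2 gam : S -> endo S, gamma_function gam & sub_of_gamma gam = H.
Proof.
move=> HP; have [[Hmul _] [[_ Hinj Hsurj] _ G3 _]] := HP.
have /choice[gam gamH] : forall x, exists f : endo S, H (f, x).
  by move=> x; have [[f y] ? /= <-] := Hsurj x I; exists f.
have HE (f : endo S) x : H (f, x) -> f = gam x.
  move=> Hf; have := Hinj _ _ (mem_set Hf) (mem_set (gamH x)) erefl.
  by case.
have subE : sub_of_gamma gam = H.
  by apply/seteqP; split=> -[f x]; [move=> /graph_fst ->|move=> /HE ->].
exists gam => //.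
have gM x y : endo_comp (gam x) (gam y) = gam (brace_of_gamma gam x y).
  exact: HE (Hmul _ _ (gamH x) (gamH y)).
have gz x y : zero_at x + gam x y = gam x y by exact: G3.
apply: (gamma_of_weak_left_brace gz).
by apply: (weak_left_brace_of_good gM gz); rewrite subE.
Qed.

(** * Dual Gamma functions and the Clifford condition *)

Lemma dual_gammaP gam : dual_gamma_function gam <->
  gamma_function gam /\ clifford_semigroup (brace_of_gamma gam).
Proof.
split=> [dgam|[gamP cl]].
  have gM := gammaE (dgammaM dgam); have gz := dgamma_zero_add dgam.
  have inj x a b : zero_at a = zero_at x -> zero_at b = zero_at x ->
      gam x a = gam x b -> a = b.
    by move=> ax bx; have [_ + _] := dgamma_aut dgam x; apply; rewrite inE.
  have fix_class x a : zero_at a = zero_at x -> zero_at (gam x a) = zero_at x.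
    by have [+ _ _] := dgamma_aut dgam x; apply.
  (* On the class of [x], [gam (zero_at x)] is injective and idempotent under composition, hence the
     identity. *)
  have g0 x a : zero_at a = zero_at x -> gam (zero_at x) a = a.
    move=> ax; have x0 := zero_at_id (zero_at_idem x).
    apply: (inj (zero_at x)); rewrite ?x0 //.
      by rewrite fix_class ?x0.
    have ee := zero_at_idem x.
    by rewrite gM /brace_of_gamma (dgamma_idem dgam ee ee) !ee.
  (* Take [y] as the preimage of [- x] under [gam x]. Then [gam x] sends both [gam y x] and [- y] to
     [x], so they agree by injectivity. *)
  have inv x : exists y,
      [/\ zero_at y = zero_at x, gam x y = - x & gam y x = - y].
    have [_ _ /(_ (- x))] := dgamma_aut dgam x.
    rewrite /zero_class /= zero_at_opp => /(_ erefl)[y /= yx xy].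
    exists y; split=> //; apply: (inj x).
    + by rewrite fix_class.
    + by rewrite zero_at_opp.
    + by rewrite gM /brace_of_gamma xy subxx g0 // endo_opp xy opp_opp.
  have gamP : gamma_function gam.
    split.
    - exact: dgammaM dgam.
    - by move=> x; rewrite g0.
    - exact: gz.
    (* [gam x] fixes [zero_at x], since it preserves the class and idempotents, so [x] and
       [zero_at x] have the same image. *)
    - move=> x xx; apply: (inj x) => //.
        by rewrite zero_at_id //; exact: zero_at_idem.
      by rewrite xx endo_zero_at fix_class.
    - by move=> x; have [y [_ ? ?]] := inv x; exists y.
    - exact: dgamma_idem dgam.
  have [invS _ mulV] := gamma_brace gamP.
  split=> //; split=> // x x' xx'.
  have [y [yx xy yy]] := inv x.
  have xV : brace_of_gamma gam x y = zero_at x.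
    by rewrite /brace_of_gamma xy subxx.
  have yV : brace_of_gamma gam y x = zero_at y.
    by rewrite /brace_of_gamma yy subxx.
  have xyP : inverse_of (brace_of_gamma gam) x y.
    by rewrite /inverse_of xV yV /brace_of_gamma !g0 // !zero_at_add.
  by rewrite (inverse_of_uniq invS xx' xyP) xV yV.
have [invS _ mulV] := gamma_brace gamP.
have gM := gammaE (gammaM gamP); have gz := gamma_zero_add gamP.
have mul0 x : brace_of_gamma gam (zero_at x) x = x.
  by rewrite /brace_of_gamma (gamma_zero_id gamP) zero_at_add.
(* The Clifford condition enters here: [zero_at x = x x' = x' x]. Hence [gam x] fixes [zero_at x],
   so it preserves the class of [x]. *)
have mulr0 x : brace_of_gamma gam x (zero_at x) = x.
  have [x' xx'] := inverse_of_ex invS x.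
  have := mulV _ _ xx'; rewrite -/(zero_at x) => <-.
  by rewrite -(cl.2 _ _ xx') invS.1 xx'.1.
have fix_class x a : zero_at a = zero_at x -> zero_at (gam x a) = zero_at x.
  by move=> ax; rewrite -endo_zero_at ax (gamma_opp_mul gz) mulr0.
have g0 x a : zero_at a = zero_at x -> gam (zero_at x) a = a.
  by move=> <-; rewrite (gamma_zero_id gamP).
split.
(* The inverse of [gam x] on the class is [gam x']: both [x x'] and [x' x] equal [zero_at x], which
   acts there as the identity. *)
- move=> x; have [x' xx'] := inverse_of_ex invS x.
  have xV := mulV _ _ xx'; have x'V := mulV _ _ (inverse_ofC xx').
  have x'x : zero_at x' = zero_at x.
    by rewrite /zero_at -xV -x'V (cl.2 _ _ xx').
  split=> [a|a b|a] /=.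
  + exact: fix_class.
  + rewrite !inE => /= ax bx /(congr1 (gam x')).
    by rewrite !gM x'V -/(zero_at x') x'x !g0.
  + move=> ax; exists (gam x' a).
      by rewrite /zero_class /= -x'x fix_class ?x'x.
    by rewrite gM xV g0.
- exact: gammaM gamP.
- exact: gz.
- exact: gamma_idem gamP.
Qed.

(** Only surjectivity of the two maps out of [Gam] has to be supplied: a graph determines its
    function, and absorption recovers [gam] from its operation. The third bijection follows from the
    commuting triangle. Stated for arbitrary [B], [G], [Gam] so as to serve both versions. *)
Lemma equivalent_data_of_gamma (B : set (S -> S -> S))
    (G : set (set (endo S * S))) (Gam : set (S -> endo S)) :
  (forall gam, Gam gam -> forall x y, zero_at x + gam x y = gam x y) ->
  (forall gam, Gam gam -> B (brace_of_gamma gam)) ->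
  (forall mul, B mul ->
    exists2 gam : S -> endo S, Gam gam & brace_of_gamma gam = mul) ->
  (forall gam, Gam gam -> G (sub_of_gamma gam)) ->
  (forall H, G H ->
    exists2 gam : S -> endo S, Gam gam & sub_of_gamma gam = H) ->
  equivalent_data B G Gam.
Proof.
move=> gz GamB BGam GamG GGam.
have subE gam : Gam gam -> sub_of_brace (brace_of_gamma gam) = sub_of_gamma gam.
  move=> /gz gamz; apply/seteqP; split=> -[f x] fx.
    by apply: endo_eqP => y; rewrite [LHS]fx -(gamma_opp_mul gamz).
  by move=> y /=; rewrite (graph_fst fx) (gamma_opp_mul gamz).
have sub_inj gam gam' : sub_of_gamma gam = sub_of_gamma gam' -> gam = gam'.
  move=> gg; apply/funext => x.
  have : sub_of_gamma gam (gam x, x) by [].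
  by rewrite gg.
split=> //; split.
- by move=> _ /BGam[gam /[dup] /subE + /GamG + <-] => ->.
- move=> mul mul'; rewrite !inE => /BGam[gam gamP <-] /BGam[gam' gamP' <-].
  by rewrite !subE // => /sub_inj ->.
- move=> _ /GGam[gam gamP <-]; exists (brace_of_gamma gam); first exact: GamB.
  exact: subE.
- exact: GamG.
- by move=> gam gam' _ _; exact: sub_inj.
- exact: GGam.
- exact: GamB.
- move=> gam gam'; rewrite !inE => /gz gamz /gz; exact: brace_of_gamma_inj.
- exact: BGam.
Qed.

End CliffordSemigroups.

Theorem theorem3p14 (S : inverseSemigroup) (cliffordS : clifford S) :
  equivalent_data (@weak_left_brace S) (@good_inverse_subsemigroup S)
    (@gamma_function S) /\
  equivalent_data (@dual_weak_left_brace S) (@good_clifford_subsemigroup S)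
    (@dual_gamma_function S).
Proof.
have brace_gamma mul : weak_left_brace mul ->
    exists2 gam : S -> endo S, gamma_function gam & brace_of_gamma gam = mul.
  move=> mulP; exists (brace_lambda mulP); first exact: brace_lambda_gamma.
  exact: brace_of_lambda.
split; apply: equivalent_data_of_gamma => //.
- by move=> gam; exact: gamma_zero_add.
- exact: gamma_brace.
- exact: gamma_good.
- exact: good_gamma.
(* The dual version restricts the plain one: [dual_gammaP] and [clifford_subsemigroup_graph]
   translate the Clifford condition on the operation. *)
- by move=> gam; exact: dgamma_zero_add.
- by move=> gam /(dual_gammaP cliffordS)[/(gamma_brace cliffordS)].
- move=> mul [/brace_gamma[gam gamP <-] cl].
  by exists gam => //; apply/(dual_gammaP cliffordS).
- move=> gam /(dual_gammaP cliffordS)[gamP cl].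
  split; last exact: (gamma_good cliffordS gamP).2.
  exact/(clifford_subsemigroup_graph (gammaM gamP)).
- move=> H [cl HP].
  have [gam gamP HE] := good_gamma cliffordS (conj cl.1 HP).
  exists gam => //; apply/(dual_gammaP cliffordS); split=> //.
  by apply/(clifford_subsemigroup_graph (gammaM gamP)); rewrite HE.
Qed.
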